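(* If $(\prec)$ is a total order on $\mathbb{Z}$, then $\mathrm{LowerArcs}(\prec)$ is a non-crossing collection. The map $(\prec)\mapsto\mathrm{LowerArcs}(\prec)$ restricts to a bijection from widely generated total orders (widely generated elements of $\mathrm{WO}(\mathrm{Tot})$) to non-crossing collections of arcs. The inverse sends a non-crossing collection $D$ to $\bigvee_{\mathfrak a\in D}j_{\mathfrak a}$, the join being taken in $\mathrm{WO}(\mathrm{Tot})$.
   Context: $\mathrm{Tot}$ is the set of all (strict) total orders $\prec$ on $\mathbb{Z}$; $<$ denotes the usual order. $N(\prec)$ is the set of pairs $(a,b)$ with $a<b$ and $b\prec a$. $\mathrm{WO}(\mathrm{Tot})$ is $\mathrm{Tot}$ partially ordered by $(\prec_1)\le(\prec_2)$ iff $N(\prec_1)\subseteq N(\prec_2)$; it is a complete lattice. An arc is a tuple $\mathfrak a=(a,b,L,R)$ with $a<b$ integers and $L\sqcup R=\{a+1,\dots,b-1\}$. Two arcs $(a,b,L,R)$ and $(a',b',L',R')$ cross if $a=a'$, or $b=b'$, or both of the sets $(L\cap R')\cup(\{a,b\}\cap R')\cup(L\cap\{a',b'\})$ and $(R\cap L')\cup(\{a,b\}\cap L')\cup(R\cap\{a',b'\})$ are nonempty. A non-crossing collection is a (possibly infinite) set of arcs no two distinct members of which cross. A pair $(a,b)$ with $a<b$ is a lower wall of $\prec$ if $b\prec a$ and there is no $c$ with $b\prec c\prec a$. An arc $(a,b,L,R)$ is a lower arc of $\prec$ if $(a,b)$ is a lower wall of $\prec$, $\ell\prec b$ for all $\ell\in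 L$, and $a\prec r$ for all $r\in R$. $\mathrm{LowerArcs}(\prec)$ is the set of lower arcs of $\prec$. For an arc $\mathfrak a=(a,b,L,R)$ with $L=\{\ell_1<\dots<\ell_j\}$, $R=\{r_1<\dots<r_k\}$, $j_{\mathfrak a}$ is the total order $\cdots\prec a-2\prec a-1\prec\ell_1\prec\cdots\prec\ell_j\prec b\prec a\prec r_1\prec\cdots\prec r_k\prec b+1\prec b+2\prec\cdots$. An element $x$ of a poset is widely generated if for all $y<x$ there is a cover relation $x'\lessdot x$ with $y\le x'$. *)

(* Defs.v *)
From HB Require Import structures.
From mathcomp Require Import all_boot all_order all_algebra.
From mathcomp Require Import boolp classical_sets functions.

Set Implicit Arguments.
Unset Strict Implicit.
Unset Printing Implicit Defensive.

Import Order.TTheory GRing.Theory Num.Theory.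

Local Open Scope classical_set_scope.
Local Open Scope ring_scope.

Section Poset.
Context {d : Order.disp_t} {T : porderType d}.

Definition covered_by (x' x : T) : Prop :=
  (x' < x)%O /\ ~ exists z, (x' < z)%O /\ (z < x)%O.

Definition widely_generated (x : T) : Prop :=
  forall y, (y < x)%O -> exists2 x', covered_by x' x & (y <= x')%O.

End Poset.

Record Tot := MkTot {
  prec :> rel int;
  prec_irr : irreflexive prec;
  prec_trans : transitive prec;
  prec_total : forall x y, x != y -> prec x y || prec y x
}.

Definition inversions (p : Tot) : set (int * int) :=
  [set xy | xy.1 < xy.2 /\ p xy.2 xy.1].

Lemma Tot_eq (p q : Tot) : prec p =2 prec q -> p = q.
Proof.
case: p => p p1 p2 p3; case: q => q q1 q2 q3 /= e.
have {e} e : p = q by apply/funext => x; apply/funext => y.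
by subst q; congr MkTot; exact: Prop_irrelevance.
Qed.

Lemma prec_asym (p : Tot) x y : x != y -> p x y = ~~ p y x.
Proof.
move=> nxy; have := prec_total p nxy.
case pyx : (p y x); case pxy : (p x y) => //= _.
by rewrite -(prec_irr p x) (prec_trans pxy pyx).
Qed.

Lemma inversions_inj : injective inversions.
Proof.
move=> p q e; apply: Tot_eq.
have H x y : x < y -> p y x = q y x.
  move=> xy; have /propeqP[h1 h2] : inversions p (x, y) = inversions q (x, y).
    by rewrite e.
  by apply/idP/idP => h; [case: h1 | case: h2].
move=> x y; case: (ltgtP x y) => [xy|yx|->]; last by rewrite !prec_irr.
- have nxy : x != y by rewrite lt_eqF.
  by rewrite (prec_asym p nxy) (prec_asym q nxy) H.
- exact: H.
Qed.

HB.instance Definition _ := gen_eqMixin Tot.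
HB.instance Definition _ := gen_choiceMixin Tot.

Definition wo_le (p q : Tot) : bool := `[< inversions p `<=` inversions q >].

Lemma wo_le_refl : reflexive wo_le.
Proof. by move=> p; apply/asboolP. Qed.

Lemma wo_le_anti : antisymmetric wo_le.
Proof.
move=> p q /andP[/asboolP pq /asboolP qp].
by apply: inversions_inj; apply/seteqP.
Qed.

Lemma wo_le_trans : transitive wo_le.
Proof.
move=> q p r /asboolP pq /asboolP qr; apply/asboolP.
exact: subset_trans pq qr.
Qed.

Fact wo_display : Order.disp_t. Proof. exact: (Order.Disp tt tt). Qed.

(* From here on, [<=] and [<] on [Tot] are those of the weak order. *)
HB.instance Definition _ :=
  Order.Le_isPOrder.Build wo_display Tot wo_le_refl wo_le_anti wo_le_trans.

Lemma wo_leE (p q : Tot) :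
  (p <= q)%O = `[< inversions p `<=` inversions q >].
Proof. by []. Qed.

Record zarc := MkArc {
  src : int;
  tgt : int;
  lft : set int;
  rgt : set int;
  src_lt_tgt : src < tgt;
  lft_rgt_disj : lft `&` rgt = set0;
  lft_rgt_cover : lft `|` rgt = [set x | src < x < tgt]
}.

Definition ends (u : zarc) : set int := [set src u; tgt u].

Definition cross (u v : zarc) : Prop :=
  [\/ src u = src v,
      tgt u = tgt v |
      (lft u `&` rgt v) `|` (ends u `&` rgt v) `|` (lft u `&` ends v) !=set0 /\
      (rgt u `&` lft v) `|` (ends u `&` lft v) `|` (rgt u `&` ends v) !=set0].

Definition noncrossing (D : set zarc) : Prop :=
  forall u v, D u -> D v -> u <> v -> ~ cross u v.

Definition lower_wall (p : Tot) (a b : int) : Prop :=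
  [/\ a < b, p b a & ~ exists c, p b c /\ p c a].

Definition lower_arc (p : Tot) (u : zarc) : Prop :=
  [/\ lower_wall p (src u) (tgt u),
      forall l, lft u l -> p l (tgt u) &
      forall r, rgt u r -> p (src u) r].

Definition lower_arcs (p : Tot) : set zarc := [set u | lower_arc p u].

(* Position of [x] in the block decomposition of the order attached to [u]:
   (-oo, src) ; lft ; tgt ; src ; rgt ; (tgt, +oo).  Inside each block the
   usual order of the integers is kept. *)
Definition arc_block (u : zarc) (x : int) : nat :=
  if x < src u then 0
  else if x \in lft u then 1
  else if x == tgt u then 2
  else if x == src u then 3
  else if x \in rgt u then 4
  else 5.

Definition arc_prec (u : zarc) : rel int := fun x y =>
  (arc_block u x < arc_block u y)%N
  || (arc_block u x == arc_block u y) && (x < y).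

Lemma arc_prec_irr u : irreflexive (arc_prec u).
Proof. by move=> x; rewrite /arc_prec ltnn ltxx andbF. Qed.

Lemma arc_prec_trans u : transitive (arc_prec u).
Proof.
move=> y x z; rewrite /arc_prec.
case/orP=> [xy|/andP[/eqP-> xy]]; case/orP=> [yz|/andP[/eqP<- yz]].
- by rewrite (ltn_trans xy yz).
- by rewrite xy.
- by rewrite yz.
- by rewrite eqxx (lt_trans xy yz) orbT.
Qed.

Lemma arc_prec_total u x y : x != y -> arc_prec u x y || arc_prec u y x.
Proof.
by rewrite /arc_prec; case: (ltngtP (arc_block u x)) => //= _; case: ltgtP.
Qed.

Definition jarc (u : zarc) : Tot :=
  MkTot (@arc_prec_irr u) (@arc_prec_trans u) (@arc_prec_total u).

(* Main.v *)
(* The inversion set of a join is the transitive closure of the union of the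
   inversion sets, and jarc u inverts the pairs x < y of [src u, tgt u] with
   x weakly on the right of u and y weakly on its left.  If D is noncrossing,
   a chain of inversions that leaves the left side of some u in D below tgt u,
   or enters its right side above src u, would use an arc crossing u; hence u
   stays a lower arc of the join p of the jarc u.  Reversing the wall of u in p
   gives an element covered by p, so p is widely generated.  Conversely every
   element covered by p misses a wall of p, which makes a widely generated p
   the join of the jarc u over its own lower arcs u. *)
Require Import Defs.
From Stdlib Require Import Relation_Operators.
From mathcomp Require Import all_boot all_order all_algebra.
From mathcomp Require Import boolp classical_sets functions.
From mathcomp Require Import zify.

Set Implicit Arguments.
Unset Strict Implicit.
Unset Printing Implicit Defensive.

Import Order.TTheory GRing.Theory Num.Theory.

Local Open Scope ring_scope.
Local Open Scope classical_set_scope.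

(** * The weak order and total orders given by their inversions *)

Lemma wo_leP (p q : Tot) :
  reflect (forall x y, x < y -> p y x -> q y x) (p <= q)%O.
Proof.
apply: (iffP (asboolP _)) => [pq x y xy pyx|pq [x y] /= [xy pyx]].
  by have [] := pq (x, y) (conj xy pyx).
by split=> //; exact: pq.
Qed.

Lemma wo_le_noninv (p q : Tot) x y :
  (p <= q)%O -> x < y -> q x y -> p x y.
Proof.
move=> /wo_leP pq xy qxy.
have nxy : x != y by rewrite lt_eqF.
rewrite (prec_asym p nxy); apply/negP => /(pq _ _ xy).
by rewrite (prec_asym q) 1?eq_sym // qxy.
Qed.

Lemma prec_asymF (p : Tot) x y : p x y -> p y x -> False.
Proof. by move=> pxy pyx; have := prec_trans pxy pyx; rewrite prec_irr. Qed.

Lemma precNle (p : Tot) x y : ~~ p x y -> p y x \/ x = y.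
Proof.
case: (eqVneq x y) => [->|nxy]; first by right.
by rewrite (prec_asym p nxy) negbK; left.
Qed.

(** Transitivity of [N] and of its complement on increasing triples is exactly what makes the
    relation [r] transitive: each relative position of three integers uses one of the two. *)
Lemma Tot_of_inversions (N : int -> int -> Prop) :
    (forall x y z, x < y -> y < z -> N x y -> N y z -> N x z) ->
    (forall x y z, x < y -> y < z -> N x z -> N x y \/ N y z) ->
  exists p : Tot, forall x y, x < y -> p y x <-> N x y.
Proof.
move=> Ntr Nco.
pose r x y := (x < y) && ~~ `[< N x y >] || (y < x) && `[< N y x >].
have rlt x y : x < y -> r x y = ~~ `[< N x y >].
  by move=> xy; rewrite /r xy (ltNge y) (ltW xy) orbF.
have rgt x y : x < y -> r y x = `[< N x y >].
  by move=> xy; rewrite /r xy (ltNge y) (ltW xy).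
have rirr : irreflexive r by move=> x; rewrite /r ltxx.
have rtot x y : x != y -> r x y || r y x.
  case: ltgtP => // xy _; rewrite !(rlt _ _ xy, rgt _ _ xy).
    exact: orNb.
  exact: orbN.
have rtr : transitive r.
  move=> y x z; case: (ltgtP x y) => [xy|yx|<-]; last by rewrite rirr.
    rewrite (rlt _ _ xy) => /asboolP nxy.
    case: (ltgtP y z) => [yz|zy|<-]; last by rewrite rirr.
      rewrite (rlt _ _ yz) => /asboolP nyz.
      rewrite (rlt _ _ (lt_trans xy yz)); apply/asboolP.
      by move=> /(Nco _ _ _ xy yz) [].
    rewrite (rgt _ _ zy) => /asboolP nzy.
    case: (ltgtP x z) => [xz|zx|xz].
    - rewrite (rlt _ _ xz); apply/asboolP => nxz; apply: nxy.
      exact: Ntr nxz nzy.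
    - rewrite (rgt _ _ zx); apply/asboolP.
      by have [] := Nco _ _ _ zx xy nzy.
    - by rewrite -xz in nzy.
  rewrite (rgt _ _ yx) => /asboolP nyx.
  case: (ltgtP y z) => [yz|zy|<-]; last by rewrite rirr.
    rewrite (rlt _ _ yz) => /asboolP nyz.
    case: (ltgtP x z) => [xz|zx|xz].
    - rewrite (rlt _ _ xz); apply/asboolP => nxz; apply: nyz.
      exact: Ntr nyx nxz.
    - rewrite (rgt _ _ zx); apply/asboolP.
      by have [] := Nco _ _ _ yz zx nyx.
    - by rewrite xz in nyx.
  rewrite (rgt _ _ zy) (rgt _ _ (lt_trans zy yx)) => /asboolP nzy.
  by apply/asboolP; exact: Ntr nzy nyx.
exists (MkTot rirr rtr rtot) => x y xy /=; rewrite (rgt _ _ xy).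
by split=> [/asboolP|/asboolP].
Qed.

(** * Joins as transitive closures of inversions *)

Definition inv_in (A : set Tot) (x y : int) : Prop :=
  x < y /\ exists2 p, A p & prec p y x.

Local Notation chain A := (clos_trans int (inv_in A)).

Lemma chain_lt A x y : chain A x y -> x < y.
Proof. by elim=> {x y} [x y []//|x y z _ xy _]; exact: lt_trans. Qed.

Lemma chain_ub A (q : Tot) x y : ubound A q -> chain A x y -> q y x.
Proof.
move=> uq; elim=> {x y} [x y [xy [p Ap pyx]]|x y z _ yx _ zy].
  by have /wo_leP := uq _ Ap; exact.
exact: prec_trans zy yx.
Qed.

(* A union of inversion sets is cotransitive, and so is its transitive
   closure: a chain jumping over [y] can be cut at [y]. *)
Lemma ex_join (A : set Tot) :
  exists p : Tot, isLub A p /\ (forall x y, x < y -> p y x <-> chain A x y).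
Proof.
have [|x y z xy yz /[dup] xz|p Hp] := @Tot_of_inversions (clos_trans _ (inv_in A)).
- by move=> x y z _ _; exact: t_trans.
- elim: xz y xy yz => {x z} [x z [xz [p Ap pzx]] y xy yz _|].
    case pyx : (p y x); first by left; apply: t_step; split=> //; exists p.
    right; apply: t_step; split=> //; exists p => //.
    have pxy : p x y by rewrite prec_asym ?lt_eqF// pyx.
    exact: prec_trans pzx pxy.
  move=> x w z xw IHx wz IHz y xy yz _.
  case: (ltgtP y w) => [yw|wy|->]; last by left.
    by case: (IHx y xy yw xw) => [|c]; [left|right; exact: t_trans c wz].
  by case: (IHz y wy yz wz) => [c|]; [left; exact: t_trans xw c|right].
exists p; split=> //; split.
  move=> q Aq; apply/wo_leP => x y xy qyx; apply/Hp => //.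
  by apply: t_step; split=> //; exists q.
by move=> q uq; apply/wo_leP => x y xy /(Hp _ _ xy); exact: chain_ub.
Qed.

Lemma isLub_inversions A (p : Tot) x y :
  isLub A p -> x < y -> p y x <-> chain A x y.
Proof.
move=> lp xy; have [q [lq Hq]] := ex_join A; suff -> : p = q by exact: Hq.
by apply/le_anti/andP; split; [apply: lp.2; exact: lq.1|apply: lq.2; exact: lp.1].
Qed.

(** * Sides of an arc, crossing, and the inversions of [jarc] *)

Definition side (u : zarc) (x : int) : int :=
  if x \in lft u then -1 else if x \in rgt u then 1 else 0.

Lemma lft_rgt_arc u x : lft u x \/ rgt u x <-> src u < x < tgt u.
Proof. by rewrite -/([set x | src u < x < tgt u] x) -lft_rgt_cover. Qed.

Lemma lft_arc u x : lft u x -> src u < x < tgt u.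
Proof. by move=> l; apply/lft_rgt_arc; left. Qed.

Lemma rgt_arc u x : rgt u x -> src u < x < tgt u.
Proof. by move=> r; apply/lft_rgt_arc; right. Qed.

Lemma side_lft u x : lft u x -> side u x = -1.
Proof. by move=> l; rewrite /side mem_set. Qed.

Lemma side_rgt u x : rgt u x -> side u x = 1.
Proof.
move=> r; rewrite /side; case: ifPn => [/set_mem l|_]; last by rewrite mem_set.
by have : (lft u `&` rgt u) x by []; rewrite lft_rgt_disj.
Qed.

Lemma side_out u x : ~ (src u < x < tgt u) -> side u x = 0.
Proof.
move=> ux; rewrite /side; case: ifPn => [/set_mem l|_].
  by case: ux; exact: lft_arc.
by case: ifPn => [/set_mem r|//]; case: ux; exact: rgt_arc.
Qed.

Variant arc_pos (u : zarc) (x : int) : nat -> int -> Prop :=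
| PosLow of x < src u : arc_pos u x 0 0
| PosLft of lft u x & src u < x < tgt u : arc_pos u x 1 (-1)
| PosTgt of x = tgt u : arc_pos u x 2 0
| PosSrc of x = src u : arc_pos u x 3 0
| PosRgt of rgt u x & src u < x < tgt u : arc_pos u x 4 1
| PosHigh of tgt u < x : arc_pos u x 5 0.

Lemma arc_posP u x : arc_pos u x (arc_block u x) (side u x).
Proof.
have ab := src_lt_tgt u; rewrite /arc_block.
case: ltP => xa; first by rewrite side_out; [exact: PosLow|lia].
case: ifPn => [/set_mem l|nl].
  by rewrite (side_lft l); apply: PosLft => //; exact: lft_arc.
case: eqP => [->|xb]; first by rewrite side_out; [exact: PosTgt|lia].
case: eqP => [->|xa']; first by rewrite side_out; [exact: PosSrc|lia].
case: ifPn => [/set_mem r|nr].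
  by rewrite (side_rgt r); apply: PosRgt => //; exact: rgt_arc.
have ux : ~ (src u < x < tgt u).
  move=> /lft_rgt_arc[/mem_set l|/mem_set r]; first by rewrite l in nl.
  by rewrite r in nr.
by rewrite side_out//; apply: PosHigh; lia.
Qed.

Lemma side_src u : side u (src u) = 0.
Proof. by apply: side_out; rewrite ltxx. Qed.

Lemma side_tgt u : side u (tgt u) = 0.
Proof. by apply: side_out; rewrite ltxx andbF. Qed.

(** Numbering left, ends and right by -1, 0, 1 turns the first crossing set into a strict inequality
    of sides; the second set is the same with [u] and [v] exchanged. *)
Lemma side_lt_cross u v x : src u <= x <= tgt u -> src v <= x <= tgt v ->
  side u x < side v x ->
  ((lft u `&` rgt v) `|` (ends u `&` rgt v) `|` (lft u `&` ends v)) x.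
Proof.
move=> ux vx; case: (arc_posP u x) => [?|lu _|xu|xu|ru _|?];
  case: (arc_posP v x) => [?|lv _|xv|xv|rv _|?] // _; try lia.
- by right; split=> //; right.
- by right; split=> //; left.
- by left; left.
- by left; right; split=> //; right.
- by left; right; split=> //; left.
Qed.

Lemma noncross_sides u v x y : ~ cross u v ->
  src u <= x <= tgt u -> src v <= x <= tgt v ->
  src u <= y <= tgt u -> src v <= y <= tgt v ->
  side u x < side v x -> side u y <= side v y.
Proof.
move=> nc ux vx uy vy xlt; rewrite leNgt; apply/negP => ylt; apply: nc.
apply: Or33; split; first by exists x; exact: side_lt_cross.
by exists y; case: (side_lt_cross vy uy ylt) => [[[]|[]]|[]] a b;
  [left; left|right|left; right].
Qed.

(** An inversion goes from the blocks of [src u] and [rgt u] to those of [lft u] and [tgt u]. Side 0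
    also allows [x = tgt u] or [y = src u], but the bounds and [x < y] exclude these. *)
Lemma jarc_inv u x y : x < y ->
  jarc u y x <-> [/\ src u <= x, y <= tgt u, 0 <= side u x & side u y <= 0].
Proof.
have ab := src_lt_tgt u; move=> xy; rewrite /= /arc_prec.
by case: (arc_posP u x) => [|||||]; case: (arc_posP u y) => [|||||] *;
  (split => [|[]]; [|lia]) => H; try split; lia.
Qed.

Lemma rgtE u : rgt u = [set x | src u < x < tgt u] `\` lft u.
Proof.
rewrite -lft_rgt_cover setDUl setDv set0U; apply/esym/setDidPl.
by rewrite setIC lft_rgt_disj.
Qed.

Lemma zarc_eq u v :
  src u = src v -> tgt u = tgt v -> lft u = lft v -> u = v.
Proof.
move=> es et el; have := rgtE v; rewrite -es -et -el -rgtE.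
case: u v es et el => [a b L R H1 H2 H3] [a' b' L' R' H1' H2' H3'] /= es et el er.
by subst; congr MkArc; exact: Prop_irrelevance.
Qed.

(** * Lower arcs of one order do not cross *)

Lemma wall_predecessor (p : Tot) a b c :
  lower_wall p a b -> p c a -> c = b \/ p c b.
Proof.
case=> _ _ nw ca; case: (eqVneq c b) => [|cb]; [by left|right].
by rewrite (prec_asym p cb); apply/negP => bc; apply: nw; exists c.
Qed.

Lemma wall_successor (p : Tot) a b c :
  lower_wall p a b -> p b c -> c = a \/ p a c.
Proof.
case=> _ _ nw bc; case: (eqVneq c a) => [|ca]; [by left|right].
by rewrite (prec_asym p) 1?eq_sym//; apply/negP => ?; apply: nw; exists c.
Qed.

(** The order decides the side of each inner point, so a lower arc is determined by its wall. *)
Lemma lower_arc_lft (p : Tot) u x :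
  lower_arc p u -> lft u x <-> src u < x < tgt u /\ p x (tgt u).
Proof.
case=> [[_ ba _] pl pr]; split=> [l|[/lft_rgt_arc[//|r xb]]].
  by split; [exact: lft_arc|exact: pl].
by have /prec_asymF[] := pr _ r; exact: prec_trans xb ba.
Qed.

Lemma lower_arc_ext (p : Tot) u v : lower_arc p u -> lower_arc p v ->
  src u = src v -> tgt u = tgt v -> u = v.
Proof.
move=> pu pv es et; apply: zarc_eq => //; apply/seteqP; split=> x.
  by move=> /(lower_arc_lft _ pu); rewrite es et => /(lower_arc_lft _ pv).
by move=> /(lower_arc_lft _ pv); rewrite -es -et => /(lower_arc_lft _ pu).
Qed.

(** The target is the immediate predecessor of the source in [p]. *)
Lemma lower_arc_src_inj (p : Tot) u v :
  lower_arc p u -> lower_arc p v -> src u = src v -> u = v.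
Proof.
move=> pu pv es; apply: (lower_arc_ext pu pv es).
have [[wu _ _] [wv _ _]] := (pu, pv); rewrite -es in wv.
have [_ bu _] := wu; have [_ bv _] := wv.
case: (wall_predecessor wu bv) => // uv; case: (wall_predecessor wv bu) => //.
by move=> /(prec_asymF uv).
Qed.

Lemma lower_arc_tgt_inj (p : Tot) u v :
  lower_arc p u -> lower_arc p v -> tgt u = tgt v -> u = v.
Proof.
move=> pu pv et; apply: (lower_arc_ext pu pv) => //.
have [[wu _ _] [wv _ _]] := (pu, pv); rewrite -et in wv.
have [_ bu _] := wu; have [_ bv _] := wv.
case: (wall_successor wu bv) => // uv; case: (wall_successor wv bu) => //.
by move=> /(prec_asymF uv).
Qed.

(* The blocks [tgt u, src u] and [tgt v, src v] are intervals of [p], so each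
   of the two clauses in the definition of crossing decides their order. *)
Lemma cross_src (p : Tot) u v x : lower_arc p u -> lower_arc p v ->
  ((lft u `&` rgt v) `|` (ends u `&` rgt v) `|` (lft u `&` ends v)) x ->
  src u != src v -> p (src v) (src u).
Proof.
move=> [[_ bau _] lu ru] [wv lv rv] H ne.
suff [h|//] : p (src v) (tgt u) \/ p (src v) (src u); first exact: prec_trans h bau.
case: H => [[[l r]|[[->|->] r]]|[l [xe|xe]]].
- by left; exact: prec_trans (rv _ r) (lu _ l).
- by right; exact: rv.
- by left; exact: rv.
- by left; rewrite -xe; exact: lu.
- right; have [] // := @wall_successor _ _ _ (src u) wv.
    by rewrite -xe; exact: prec_trans (lu _ l) bau.
  by move=> e; rewrite e eqxx in ne.
Qed.

Lemma noncrossing_lower_arcs (p : Tot) : noncrossing (lower_arcs p).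
Proof.
move=> u v pu pv uv [/(lower_arc_src_inj pu pv)//|/(lower_arc_tgt_inj pu pv)//|].
have [/(lower_arc_src_inj pu pv)//|ab] := eqVneq (src u) (src v).
case=> [[x ux] [y uy]]; apply: (@prec_asymF p (src u) (src v)).
  apply: (cross_src pv pu (x := y)); last by rewrite eq_sym.
  by case: uy => [[[]|[]]|[]] a b; [left; left|right|left; right].
exact: cross_src pu pv ux ab.
Qed.

(** * Arcs whose sides agree with an order *)

Definition cut_by (p : Tot) (u : zarc) : Prop :=
  (forall l, lft u l -> p l (tgt u)) /\ (forall r, rgt u r -> p (src u) r).

Lemma lower_arc_cut (p : Tot) u : lower_arc p u -> cut_by p u.
Proof. by case. Qed.

Lemma cut_by_jarc (p : Tot) u x y : cut_by p u -> x < y -> jarc u y x ->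
  (x = src u \/ p (src u) x) /\ (y = tgt u \/ p y (tgt u)).
Proof.
move=> [pl pr] xy /(jarc_inv _ xy)[ax yb sx sy]; split.
  case: (arc_posP u x) sx => [?|?|?|?|r _|?] sx; try lia.
  by right; exact: pr.
case: (arc_posP u y) sy => [?|l _|?|?|?|?] sy; try lia.
by right; exact: pl.
Qed.

Lemma cut_by_jarc_le (p : Tot) u :
  cut_by p u -> p (tgt u) (src u) -> (jarc u <= p)%O.
Proof.
move=> pu ba; apply/wo_leP => x y xy /(cut_by_jarc pu xy)[ax yb].
have {}yb : p y (src u) by case: yb => [->//|yb]; exact: prec_trans yb ba.
by case: ax => [->//|]; exact: prec_trans.
Qed.

Lemma lower_arc_jarc_le (p : Tot) u : lower_arc p u -> (jarc u <= p)%O.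
Proof. by move=> pu; apply: cut_by_jarc_le; [exact: lower_arc_cut|case: pu => [[]]]. Qed.

Lemma jarc_inv_ends u : jarc u (tgt u) (src u).
Proof.
have ab := src_lt_tgt u; apply/jarc_inv => //.
by rewrite side_src side_tgt; split; lia.
Qed.

(** Left are the inner points before [b] in [p]; by hypothesis the others come after [a]. *)
Lemma ex_cut_by (p : Tot) a b : a < b ->
    (forall c, a < c < b -> p b c -> ~ p c a) ->
  exists u, [/\ cut_by p u, src u = a & tgt u = b].
Proof.
move=> ab nw.
pose L := [set x | a < x < b /\ p x b]; pose R := [set x | a < x < b /\ ~ p x b].
have dis : L `&` R = set0 by apply/seteqP; split=> // x [[_ ?] []].
have cov : L `|` R = [set x | a < x < b].
  apply/seteqP; split=> [x [[]|[]]//|x xab].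
  by have [?|?] := EM (p x b); [left|right].
exists (MkArc ab dis cov); split=> //; split=> /= [l []//|r [rab /negP nrb]].
have [br|e] := precNle nrb; last by rewrite e ltxx andbF in rab.
have /negP/precNle[//|e] := nw _ rab br.
by rewrite e ltxx in rab.
Qed.

(** * Elements covered by an order and its walls *)

Lemma lt_inversion (p q : Tot) :
  (q < p)%O -> exists x y, [/\ x < y, p y x & ~~ q y x].
Proof.
move=> qp; apply: contrapT => H.
suff /(lt_le_trans qp) : (p <= q)%O by rewrite ltxx.
apply/wo_leP => x y xy pyx; apply/negPn/negP => nq; apply: H.
by exists x, y.
Qed.

(** A point [c] between [x] and [y] in both orders splits the pair into two shorter inversions of
    [p], and [q] cannot invert both. *)
Lemma shortest_inversion (p q : Tot) x y : x < y -> p y x -> ~~ q y x ->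
  exists a b, [/\ a < b, p b a, ~~ q b a &
    forall c, a < c < b -> p b c -> ~ p c a].
Proof.
have [n] := ubnP `|y - x|%N; elim: n => // n IH in x y *; rewrite ltnS => yxn xy pyx nq.
have [[c [xcy pyc pcx]]|nc] := EM (exists c, [/\ x < c < y, p y c & p c x]); last first.
  exists x, y; split=> // c xcy pyc pcx; apply: nc; by exists c.
have [qcx|] := boolP (q c x); last by apply: IH => //; lia.
have [qyc|] := boolP (q y c); last by apply: IH => //; lia.
by rewrite (prec_trans qyc qcx) in nq.
Qed.

(* For an inversion [(a, b)] of [p] but not of [q] with [b - a] minimal, the
   elements [p]-between [b] and [a] lie outside the interval from [a] to [b].
   Joining [q] with the join-irreducible cut out by [p] on [(a, b)] then
   inverts [(a, b)] without inverting any pair [(c, b)] or [(a, c)] with [c]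
   [p]-between [b] and [a]; so if [p] covers [q] there is no such [c]. *)
Lemma covered_by_wall (p q : Tot) :
  covered_by q p -> exists a b, lower_wall p a b /\ ~~ q b a.
Proof.
move=> [qp nb]; have [x [y [xy pyx nqyx]]] := lt_inversion qp.
have [a [b [ab pba nqba short]]] := shortest_inversion xy pyx nqyx.
have [u [pu ua ub]] := ex_cut_by ab short.
have {}qp := ltW qp.
pose A := [set q; jarc u]; have [r [[rA rl] Hr]] := ex_join A.
have qr : (q <= r)%O by apply: rA; left.
have jr : (jarc u <= r)%O by apply: rA; right.
have rba : r b a by move/wo_leP: jr; apply=> //; rewrite -ua -ub; exact: jarc_inv_ends.
have rp : (r <= p)%O.
  by apply: rl => _ [->//|->]; apply: cut_by_jarc_le => //; rewrite ua ub.
have {rp} rp : r = p.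
  have [//|nrp] := eqVneq r p; case: nb; exists r; split; last by rewrite lt_neqAle nrp.
  by rewrite lt_neqAle qr andbT; apply/eqP => e; rewrite e rba in nqba.
subst r; exists a, b; split=> //; split=> // -[c [pbc pca]].
have qab : q a b by rewrite prec_asym ?lt_eqF// nqba.
(* Inversions of [jarc u] start at [a] or after it in [p], while a chain starting before [a] only
   moves further down in [p]. Hence all its steps are inversions of [q]. *)
have from_a x' y' : chain A x' y' -> p x' a -> q y' x'.
  elim=> {x' y'} [x' y' [xy' [_ [->//|->]]]|x' z' y' xz IHl _ IHr xa].
    move=> /(cut_by_jarc pu xy')[]; rewrite ua => -[->|ax _ /(prec_asymF ax)//].
    by rewrite prec_irr.
  by apply: prec_trans (IHl xa); apply/IHr/(prec_trans _ xa)/(chain_ub rA).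
have to_b x' y' : chain A x' y' -> p b y' -> q y' x'.
  elim=> {x' y'} [x' y' [xy' [_ [->//|->]]]|x' z' y' _ IHl zy IHr yb].
    move=> /(cut_by_jarc pu xy')[_]; rewrite ub => -[->|yb /(prec_asymF yb)//].
    by rewrite prec_irr.
  by apply: prec_trans (IHr yb) _; apply/IHl/(prec_trans yb)/(chain_ub rA).
suff : q b a by apply/negP.
case: (ltgtP c a) => [ca|ac|ca]; last by rewrite ca prec_irr in pca.
  apply: prec_trans (wo_le_noninv qr ca pca).
  by apply: from_a => //; apply/Hr => //; exact: lt_trans ab.
case: (ltgtP c b) => [cb|bc|cb]; last by rewrite cb prec_irr in pbc.
  by case: (short c) => //; rewrite ac cb.
apply: prec_trans (wo_le_noninv qr bc pbc) _.
by apply: to_b => //; apply/Hr.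
Qed.

(** Exchanging two adjacent elements of [p]: no third element lies between them to spoil
    transitivity, and each third element compares alike with both. *)
Lemma flip_wall (p : Tot) a b : lower_wall p a b ->
  exists q : Tot, forall x y, x < y -> q y x <-> p y x /\ (x, y) <> (a, b).
Proof.
move=> w; have [ab ba nw] := w.
apply: (@Tot_of_inversions (fun x y => p y x /\ (x, y) <> (a, b))).
  move=> x y z xy yz [yx _] [zy _]; split; first exact: prec_trans zy yx.
  by move=> [xa zb]; subst; apply: nw; exists y.
move=> x y z xy yz [zx nxz].
have [[xa yb]|nxy] := EM ((x, y) = (a, b)).
  subst; right; case: (wall_predecessor w zx) => [zb|zb]; first by rewrite zb ltxx in yz.
  by split=> // -[ba' _]; rewrite ba' ltxx in xy.
have [[ya zb]|nyz] := EM ((y, z) = (a, b)).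
  subst; left; case: (wall_successor w zx) => [xa|ax]; first by rewrite xa ltxx in xy.
  by split=> // -[xa _]; rewrite xa ltxx in xy.
have [yx|] := boolP (p y x); first by left.
by rewrite -prec_asym ?lt_eqF// => xy'; right; split=> //; exact: prec_trans zx xy'.
Qed.

Lemma ex_lower_arc (p : Tot) a b : lower_wall p a b ->
  exists u, [/\ lower_arc p u, src u = a & tgt u = b].
Proof.
move=> w; have [ab _ nw] := w.
have [|u [[pl pr] ua ub]] := @ex_cut_by p a b ab.
  by move=> c _ bc ca; apply: nw; exists c.
by exists u; split=> //; split=> //; rewrite ua ub.
Qed.

(** * Widely generated orders as joins over their lower arcs *)

Lemma isLub_lower_arcs (p : Tot) :
  widely_generated p -> isLub (jarc @` lower_arcs p) p.
Proof.
move=> wg; have [y [[ly uy] _]] := ex_join (jarc @` lower_arcs p).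
have yp : (y <= p)%O.
  by apply: uy => _ [u pu <-]; exact: lower_arc_jarc_le.
suff e : y = p by rewrite -[X in isLub _ X]e.
(* If the join [y] were below [p], some [x'] covered by [p] would lie above [y]; but [x'] misses a
   wall of [p], whose arc is one of those joined. *)
apply: contrapT => /eqP nyp.
have [|x' xp yx'] := wg y; first by rewrite lt_neqAle nyp yp.
have [a [b [w /negP[]]]] := covered_by_wall xp.
have [u [pu <- <-]] := ex_lower_arc w.
have /wo_leP : (jarc u <= x')%O by apply: le_trans yx'; apply: ly; exists u.
by apply; [exact: src_lt_tgt|exact: jarc_inv_ends].
Qed.

Lemma isLub_inj (A : set Tot) p q : isLub A p -> isLub A q -> p = q.
Proof.
by move=> [pA pl] [qA ql]; apply/le_anti; rewrite pl// ql.
Qed.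

(** * Chains of inversions meeting an arc of a noncrossing collection *)

Lemma side0_tgt u x : src u < x <= tgt u -> side u x = 0 -> x = tgt u.
Proof. by case: (arc_posP u x) => *; lia. Qed.

Lemma side0_src u x : src u <= x < tgt u -> side u x = 0 -> x = src u.
Proof. by case: (arc_posP u x) => *; lia. Qed.

Lemma inv_in_jarc D x y : inv_in (jarc @` D) x y <->
  exists2 v, D v &
    [/\ x < y, src v <= x, y <= tgt v, 0 <= side v x & side v y <= 0].
Proof.
split=> [[xy [_ [v Dv <-] /(jarc_inv _ xy)[]]]|[v Dv [xy ? ? ? ?]]].
  by exists v.
by split=> //; exists (jarc v); [exists v|apply/jarc_inv].
Qed.

Section NoncrossingJoin.
Variables (D : set zarc) (u : zarc).
Hypotheses (Dnc : noncrossing D) (Du : D u).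

Local Notation chainD := (chain (jarc @` D)).

Lemma noncrossingP v : D v ->
  u = v \/ [/\ src u <> src v, tgt u <> tgt v, ~ cross u v & ~ cross v u].
Proof.
move=> Dv; have [->|uv] := EM (u = v); [by left|right].
have uvc := Dnc Du Dv uv; split=> // [e|e|]; [by apply: uvc; constructor..|].
by apply: Dnc => // /esym.
Qed.

(** At [x] the side of [u] is below that of the arc [v] used, so also weakly at [y], where the side
    of [v] is at most 0. Side 0 for [u] would force [y = tgt u = tgt v]. *)
Lemma chain_lft x y : chainD x y -> lft u x -> y <= tgt u -> lft u y.
Proof.
elim=> {x y} [x y /inv_in_jarc[v Dv [xy vx yv sx sy]] ux yu|x z y _ IHl zy IHr ux yu].
  have xu := lft_arc ux.
  have sux := side_lft ux.
  case: (noncrossingP Dv) => [uv|[ne1 ne2 nc _]]; first by subst v; lia.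
  have : side u y <= side v y by apply: (noncross_sides nc (x := x)); lia.
  have := @side0_tgt v y.
  by case: (arc_posP u y) => // *; lia.
by apply: IHr => //; apply: IHl => //; have := chain_lt zy; lia.
Qed.

Lemma chain_rgt x y : chainD x y -> rgt u y -> src u <= x -> rgt u x.
Proof.
elim=> {x y} [x y /inv_in_jarc[v Dv [xy vx yv sx sy]] uy xu|x z y xz IHl _ IHr uy xu].
  have yu := rgt_arc uy.
  have suy := side_rgt uy.
  case: (noncrossingP Dv) => [uv|[ne1 ne2 _ nc]]; first by subst v; lia.
  have : side v x <= side u x by apply: (noncross_sides nc (x := y)); lia.
  have := @side0_src v x.
  by case: (arc_posP u x) => // *; lia.
by apply: IHl => //; apply: IHr => //; have := chain_lt xz; lia.
Qed.

(** A step over [src u] by an arc [v] can stop there unless [src u] is on the right of [v]; then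
    noncrossing puts [y] on the left of [u], where [chain_lft] keeps the rest of the chain. *)
Lemma chain_src x y : chainD x y -> x < src u -> src u < y <= tgt u ->
  chainD x (src u) \/ lft u y.
Proof.
elim=> {x y} [x y /inv_in_jarc[v Dv [xy vx yv sx sy]] xu uy|x z y xz IHl zy IHr xu uy].
  have xv : x < tgt v by lia.
  have [sa|sa] := leP (side v (src u)) 0.
    by left; apply/t_step/inv_in_jarc; exists v => //; split=> //; lia.
  case: (noncrossingP Dv) => [uv|[ne1 ne2 nc _]]; first by subst v; lia.
  have su := side_src u.
  have : side u y <= side v y by apply: (noncross_sides nc (x := src u)); lia.
  have := @side0_tgt v y.
  by case: (arc_posP u y) => *; (lia || right).
have xz' := chain_lt xz; have zy' := chain_lt zy.
case: (ltgtP z (src u)) => [zu|uz|<-]; last by left.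
  by case: (IHr zu uy) => h; [left; exact: t_trans xz h|right].
case: (IHl xu) => [|h|h]; [lia|by left|right].
by apply: chain_lft zy h _; lia.
Qed.

Lemma chain_tgt x y : chainD x y -> src u <= x < tgt u -> tgt u < y ->
  chainD (tgt u) y \/ rgt u x.
Proof.
elim=> {x y} [x y /inv_in_jarc[v Dv [xy vx yv sx sy]] ux yu|x z y xz IHl zy IHr ux yu].
  have [sb|sb] := leP 0 (side v (tgt u)).
    by left; apply/t_step/inv_in_jarc; exists v => //; split=> //; lia.
  case: (noncrossingP Dv) => [uv|[ne1 ne2 _ nc]]; first by subst v; lia.
  have su := side_tgt u.
  have : side v x <= side u x by apply: (noncross_sides nc (x := tgt u)); lia.
  have := @side0_src v x.
  by case: (arc_posP u x) => *; (lia || right).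
have xz' := chain_lt xz; have zy' := chain_lt zy.
case: (ltgtP z (tgt u)) => [zu|uz|<-]; last by left.
  case: (IHr _ yu) => [|h|h]; [lia|by left|right].
  by apply: chain_rgt xz h _; lia.
by case: (IHl ux uz) => h; [left; exact: t_trans h zy|right].
Qed.

Lemma join_lower_arc (p : Tot) : isLub (jarc @` D) p -> lower_arc p u.
Proof.
move=> lp; have ab := src_lt_tgt u.
have Hp x y := @isLub_inversions _ p x y lp.
have ba : p (tgt u) (src u).
  have /wo_leP : (jarc u <= p)%O by apply: lp.1; exists u.
  by apply=> //; exact: jarc_inv_ends.
have pl l : lft u l -> p l (tgt u).
  move=> ul; have lu := lft_arc ul.
  rewrite prec_asym; last lia.
  apply/negP => /Hp c; have {}c : chainD l (tgt u) by apply: c; lia.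
  by have /lft_arc := (chain_lft c ul (lexx _)); rewrite ltxx andbF.
have pr r : rgt u r -> p (src u) r.
  move=> ur; have ru := rgt_arc ur.
  rewrite prec_asym; last lia.
  apply/negP => /Hp c; have {}c : chainD (src u) r by apply: c; lia.
  by have /rgt_arc := (chain_rgt c ur (lexx _)); rewrite ltxx.
split=> //; split=> // -[c [bc ca]].
have [cu|] := boolP (src u < c < tgt u).
  have /lft_rgt_arc[/pl cb|/pr ac] := cu; first exact: prec_asymF bc cb.
  exact: prec_asymF ac ca.
have nca : c != src u by apply/eqP => e; rewrite e prec_irr in ca.
have ncb : c != tgt u by apply/eqP => e; rewrite e prec_irr in bc.
(* A point [c] outside the arc is inverted with its far end, hence by [chain_src] or [chain_tgt]
   with its near end too, against its place between [tgt u] and [src u] in [p]. *)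
move=> cu; have [{}cu|{}cu] : c < src u \/ tgt u < c by lia.
  have /chain_src[||h|h] // : chainD c (tgt u) by apply/Hp => //; lia.
  - by rewrite ab lexx.
  - by have := prec_asymF ca; apply; apply/Hp.
  - by have /lft_arc := h; rewrite ltxx andbF.
have /chain_tgt[||h|h] // : chainD (src u) c by apply/Hp => //; lia.
- by rewrite ab lexx.
- by have := prec_asymF bc; apply; apply/Hp.
- by have /rgt_arc := h; rewrite ltxx.
Qed.

End NoncrossingJoin.

(** * Lower arcs and wide generation of a noncrossing join *)

Lemma lower_arcs_join (D : set zarc) p :
  noncrossing D -> isLub (jarc @` D) p -> lower_arcs p = D.
Proof.
move=> Dnc lp; apply/seteqP; split=> u; last by move=> Du; exact: join_lower_arc lp.
move=> pu; have [w _ _] := pu; have [ab ba nw] := w.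
(* An intermediate point of a chain would lie inside the wall in [p], so one arc of [D] inverts the
   wall. *)
have chain_wall x y : chain (jarc @` D) x y -> lower_wall p x y ->
    inv_in (jarc @` D) x y.
  case=> // z {}y xz zy [_ _ []]; exists z.
  by split; apply: chain_ub lp.1 _.
have /(isLub_inversions lp ab)/chain_wall/(_ w) := ba.
case=> _ [_ [v Dv <-] vba].
have pv := join_lower_arc Dnc Dv lp; have [wv _ _] := pv.
have [vab vbva _] := wv.
(* In [p] this gives [tgt u], [tgt v], [src v], [src u] in weakly increasing order; adjacency of the
   outer two forces equal sources. *)
have [va vb] := cut_by_jarc (lower_arc_cut pv) ab vba.
suff /(lower_arc_src_inj pu pv) -> : src u = src v by [].
case: va => // va; case: (wall_predecessor w va) => [e|vau].
  case: vb => [e1|vb]; first by rewrite e -e1 ltxx in vab.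
  by rewrite -e in vb; have := prec_asymF vbva vb.
case: vb => [e|vb].
  by have := prec_trans vbva vau; rewrite e prec_irr.
by case: (prec_asymF (prec_trans vbva vau) vb).
Qed.

(** An order strictly between would both contain and miss the single inversion [(a, b)]. *)
Lemma covered_by_flip (p q : Tot) a b : lower_wall p a b ->
  (forall x y, x < y -> q y x <-> p y x /\ (x, y) <> (a, b)) -> covered_by q p.
Proof.
move=> [ab ba _] qE; have qp : (q <= p)%O by apply/wo_leP => x y xy /qE[].
have nq : ~~ q b a by apply/negP => /(qE _ _ ab)[].
split; first by rewrite lt_neqAle qp andbT; apply: contraNneq nq => ->.
case=> r [qr rp]; have [x [y [xy ryx nqyx]]] := lt_inversion qr.
have [x' [y' [xy' pyx' nryx']]] := lt_inversion rp.
have /wo_leP := ltW rp => /(_ _ _ xy ryx) pyx.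
have e : (x, y) = (a, b).
  by apply: contrapT => ne; move/negP: nqyx; apply; apply/qE.
have e' : (x', y') = (a, b).
  apply: contrapT => ne; move/negP: nryx'; apply.
  by move/ltW/wo_leP: qr; apply=> //; apply/qE.
by move: e e' ryx nryx' => [-> ->] [-> ->] ->.
Qed.

(** The side conditions of [u] are non-inversions of [p], which pass down to [q]. *)
Lemma lower_arc_le (p q : Tot) u : lower_arc p u -> (q <= p)%O ->
  q (tgt u) (src u) -> (jarc u <= q)%O.
Proof.
move=> [_ pl pr] qp; apply: cut_by_jarc_le; split.
  move=> l ul; apply: (wo_le_noninv qp); last exact: pl.
  by have /lft_arc/andP[] := ul.
move=> r ur; apply: (wo_le_noninv qp); last exact: pr.
by have /rgt_arc/andP[] := ur.
Qed.

Lemma widely_generated_join (D : set zarc) p :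
  noncrossing D -> isLub (jarc @` D) p -> widely_generated p.
Proof.
move=> Dnc lp y yp.
have [u Du nuy] : exists2 u, D u & ~ (jarc u <= y)%O.
  apply: contrapT => H; suff /(lt_le_trans yp) : (p <= y)%O by rewrite ltxx.
  by apply: lp.2 => _ [u Du <-]; apply: contrapT => nuy; apply: H; exists u.
have pu := join_lower_arc Dnc Du lp; have [w _ _] := pu.
(* As [jarc u] is not below [y], the wall of [u] is not inverted by [y]; undoing that wall in [p]
   therefore stays above [y]. *)
have [q qE] := flip_wall w; exists q; first exact: covered_by_flip w qE.
apply/wo_leP => s t st yts; apply/qE => //; split.
  by move/ltW/wo_leP: yp; apply.
by move=> [es et]; apply: nuy; apply: lower_arc_le pu (ltW yp) _; rewrite -es -et.
Qed.

Theorem theorem3p17 :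
  [/\ forall p : Tot, noncrossing (lower_arcs p),
      set_bij [set p : Tot | widely_generated p] [set D | noncrossing D]
        lower_arcs &
      forall D : set zarc, noncrossing D ->
        exists p : Tot,
          [/\ isLub (jarc @` D) p, widely_generated p & lower_arcs p = D]].
Proof.
have join (D : set zarc) : noncrossing D -> exists p : Tot,
    [/\ isLub (jarc @` D) p, widely_generated p & lower_arcs p = D].
  move=> Dnc; have [p [lp _]] := ex_join (jarc @` D); exists p; split=> //.
    exact: widely_generated_join lp.
  exact: lower_arcs_join.
split=> //; first exact: noncrossing_lower_arcs.
split.
- by move=> p _; exact: noncrossing_lower_arcs.
(* Injectivity: both orders are the join over the same set of lower arcs. *)
- move=> p q /set_mem wp /set_mem wq e.
  by apply: isLub_inj (isLub_lower_arcs wp) _; rewrite e; exact: isLub_lower_arcs.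
- by move=> D /join[p [_ wp <-]]; exists p.
Qed.
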